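(* Let $X_\phi$ be a substitution tiling system in $\mathbb{R}^m$ and let $x,x'\in X_\phi$. If $x'$ has a tile $a'$ of type $j$ parallel to a tile $a$ (of type $j$) in $x$, then $\mathcal{O}_j(x)=\mathcal{O}_j(x')$. For any $\tilde x\in X_\phi$, $\mathcal{O}_j(\tilde x)$ is conjugate (in $SO(m)$) to $\mathcal{O}_j(x)$.
   Context: $G_E$ is the connected Euclidean group of $\mathbb{R}^m$, the semidirect product of $SO(m)$ with $\mathbb{R}^m$; $g=(r,t)$ denotes the rotation $r$ about the origin followed by translation by $t$, and $T^g$ denotes its action on tiles, patches and tilings. Substitution tiling systems. $\mathcal{A}$ (the alphabet) is a nonempty finite collection of polyhedra in $\mathbb{R}^m$ (polygons if $m=2$), distinct elements not being congruent under $G_E$. A tile is a copy $T^g b$ ($g\in G_E$) of some $b\in\mathcal{A}$; $b$ is its type. $X(\mathcal{A})$ is the set of all tilings of $\mathbb{R}^m$ by tiles. Congruent means congruent under $G_E$. A patch is a (finite or infinite) subset of a tiling in $X(\mathcal{A})$; $W$ is the set of all patches. A substitution function is a map $\phi:W\to W$ which acts simultaneously on all tiles of a patch by subdividing and stretching about the origin (so $\phi P=\bigcup_{a\in P}\phi a$), such that: (i) there is a constant $|\phi|>1$ such that $\phi(T^g x)=T^{\phi(g)}(\phi x)$ for all $g\in G_E$ and patches $x$, where $\phi(g)$ is the conjugate of $g$ by the similarity stretching about the origin by $|\phi|$ (so $\phi((r,t))=(r,|\phi|t)$); (ii) for each tile $a\in\mathcal{A}$ and $n\ge1$, the union of the tiles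 in $\phi^n a$ is congruent to $|\phi|^n a$, and these tiles meet full face to full face; (iii) for each $a\in\mathcal{A}$, $\phi a$ contains at least one tile of each type. The substitution tiling system $X_\phi\subset X(\mathcal{A})$ is the set of tilings $x$ such that every finite subpatch of $x$ is congruent to a subpatch of $\phi^n a$ for some $n>0$ and $a\in\mathcal{A}$. Two tiles of the same type are parallel if one is a translate of the other. For a tiling $x$ and tile $a\in x$ of type $j$, $R_j(a,x)\subset SO(m)$ is the set of rotations bringing some tile of type $j$ in $x$ parallel to $a$; the group it generates does not depend on the choice of $a$ and is denoted $\mathcal{O}_j(x)$. *)

(* Defs.v *)
From mathcomp Require Import all_boot all_order all_algebra.
From mathcomp Require Import all_classical all_reals all_analysis.

Set Implicit Arguments.
Unset Strict Implicit.
Unset Printing Implicit Defensive.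

Import Order.TTheory GRing.Theory Num.Theory.
Import numFieldNormedType.Exports.

Local Open Scope classical_set_scope.
Local Open Scope ring_scope.

Section Euclidean.
Context {R : realType} {m : nat}.
Local Notation V := 'cV[R]_m.

Definition SO : set 'M[R]_m := [set r | r *m r^T = 1%:M /\ \det r = 1].

Definition SO_subgroup (G : set 'M[R]_m) : Prop :=
  [/\ G `<=` SO, G 1%:M,
      forall r s, G r -> G s -> G (r *m s)
    & forall r, G r -> G (invmx r)].

Definition SO_generated (S : set 'M[R]_m) : set 'M[R]_m :=
  smallest SO_subgroup S.

Definition SO_conjugate (G H : set 'M[R]_m) : Prop :=
  exists2 s, SO s & H = [set s *m r *m invmx s | r in G].

(* (r, t) is the rotation r about the origin followed by translation by t. *)
Definition GE : set ('M[R]_m * V) := [set g | SO g.1].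

Definition act (g : 'M[R]_m * V) (p : V) : V := g.1 *m p + g.2.

Definition act_set (g : 'M[R]_m * V) (S : set V) : set V := act g @` S.

Definition act_patch (g : 'M[R]_m * V) (P : set (set V)) : set (set V) :=
  act_set g @` P.

Definition congruent (S S' : set V) : Prop :=
  exists2 g, GE g & S' = act_set g S.

Definition patch_congruent (P P' : set (set V)) : Prop :=
  exists2 g, GE g & P' = act_patch g P.

Definition translate (S S' : set V) : Prop :=
  exists t : V, S' = [set p + t | p in S].

Definition stretch (lam : R) (S : set V) : set V := [set lam *: p | p in S].

Definition stretch_conj (lam : R) (g : 'M[R]_m * V) : 'M[R]_m * V :=
  (g.1, lam *: g.2).

Lemma stretch_conjE lam g (p : V) :
  act (stretch_conj lam g) (lam *: p) = lam *: act g p.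
Proof. by rewrite /act /= scalerDr -scalemxAr. Qed.

Lemma mx_SO_inv r : SO r -> r \in unitmx /\ invmx r = r^T.
Proof.
move=> [rr _]; have ru : r \in unitmx by case: (mulmx1_unit rr).
by split=> //; rewrite -[RHS](mulKmx ru) rr mulmx1.
Qed.

Lemma SO_subgroupT : SO_subgroup SO.
Proof.
split=> //.
- by split; rewrite ?trmx1 ?mulmx1 ?det1.
- move=> r s [rr dr] [ss ds]; split; last by rewrite det_mulmx dr ds mulr1.
  by rewrite trmx_mul mulmxA -(mulmxA r) ss mulmx1.
- move=> r rSO; have [ru ->] := mx_SO_inv rSO; case: rSO => rr dr.
  by split; rewrite ?det_tr // trmxK; apply: mulmx1C.
Qed.

Lemma SO_generated_subgroup S : S `<=` SO -> SO_subgroup (SO_generated S).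
Proof.
move=> SSO; split.
- by move=> r; apply; split=> //; exact: SO_subgroupT.
- by move=> G [[]].
- by move=> r s Gr Gs G HG; have [[_ _ + _] _] := HG; apply;
    [exact: Gr | exact: Gs].
- by move=> r Gr G HG; have [[_ _ _ +] _] := HG; apply; exact: Gr.
Qed.

End Euclidean.

Section Tilings.
Context {R : realType} {m : nat}.
Local Notation V := 'cV[R]_m.

Definition convex_hull (S : set V) : set V :=
  smallest (@convex_set R V : set V -> Prop) S.

(* Polyhedra are solid but need not be convex. *)
Definition polyhedron (P : set V) : Prop :=
  exists (k : nat) (Q : 'I_k.+1 -> set V),
    (forall i, (Q i)° !=set0 /\
       exists2 F : set V, finite_set F & Q i = convex_hull F) /\
    P = \bigcup_i Q i.

Definition tangent_cone (P : set V) (p : V) : set V :=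
  [set v | \forall s \near (0 : R)^'+, P (p + s *: v)].

(* The relatively open face of the polyhedron P through its point p. A point
   and its translates along the face see P under the same tangent cone, so the
   open faces of all dimensions are the connected components of the level sets
   of the tangent cone; for a convex polytope they are the relative interiors
   of its faces. *)
Definition open_face (P : set V) (p : V) : set V :=
  connected_component
    [set q | P q /\ tangent_cone P q = tangent_cone P p] p.

(* P `&` Q is a union of common faces of P and Q. *)
Definition meet_full_face (P Q : set V) : Prop :=
  forall p, P p -> Q p -> open_face P p = open_face Q p.

Definition support (P : set (set V)) : set V := \bigcup_(a in P) a.

Definition alphabet (A : set (set V)) : Prop :=
  [/\ A !=set0, finite_set A, forall b, A b -> polyhedron b
    & forall b c, A b -> A c -> congruent b c -> b = c].

(* The type of a tile t is the b in A with congruent b t. *)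
Definition tile (A : set (set V)) (t : set V) : Prop :=
  exists2 b, A b & congruent b t.

(* Elements of X(A) need not be face to face; that is only imposed on the
   iterates of a substitution. *)
Definition tiling (A : set (set V)) (x : set (set V)) : Prop :=
  [/\ x `<=` tile A, support x = setT
    & forall s t, x s -> x t -> s <> t -> s° `&` t° = set0].

Definition patch (A : set (set V)) (P : set (set V)) : Prop :=
  exists2 x, tiling A x & P `<=` x.

(* phi stands for a map W -> W on the set W of patches: its values on other sets
   of tiles are irrelevant. The image of a single tile a is phi [set a]. *)
Record substitution (A : set (set V)) (phi : set (set V) -> set (set V))
    (lam : R) : Prop := Substitution {
  subst_patch : forall P, patch A P -> patch A (phi P);
  subst_tilewise : forall P, patch A P ->
    phi P = \bigcup_(a in P) phi [set a];
  subst_factor_gt1 : 1 < lam;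
  subst_equivariant : forall g P, GE g -> patch A P ->
    phi (act_patch g P) = act_patch (stretch_conj lam g) (phi P);
  subst_support : forall a n, A a -> (1 <= n)%N ->
    congruent (stretch (lam ^+ n) a) (support (iter n phi [set a]));
  subst_full_face : forall a n, A a -> (1 <= n)%N ->
    forall s t, iter n phi [set a] s -> iter n phi [set a] t -> s <> t ->
    meet_full_face s t;
  subst_primitive : forall a b, A a -> A b ->
    exists2 t, phi [set a] t & congruent b t
}.

Definition substitution_tiling (A : set (set V))
    (phi : set (set V) -> set (set V)) (x : set (set V)) : Prop :=
  tiling A x /\
  forall P, finite_set P -> P `<=` x ->
    exists n a Q, [/\ (0 < n)%N, A a, Q `<=` iter n phi [set a]
      & patch_congruent Q P].

Definition parallel (j s t : set V) : Prop :=
  [/\ congruent j s, congruent j t & translate s t].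

(* R_j(a, x); it contains the rotations fixing a up to translation (c = a). *)
Definition rel_rotations (j a : set V) (x : set (set V)) : set 'M[R]_m :=
  [set r | SO r /\
    exists2 c, x c /\ congruent j c & parallel j (act_set (r, 0) c) a].

(* O_j(x), computed from a chosen tile of type j in x; by orient_groupE the
   choice is irrelevant. *)
Definition orient_group (j : set V) (x : set (set V)) : set 'M[R]_m :=
  SO_generated
    (rel_rotations j (xget set0 [set a | x a /\ congruent j a]) x).

Lemma translate_trans (s t u : set V) : translate s t -> translate t u -> translate s u.
Proof.
move=> [v ->] [w ->]; exists (v + w); rewrite image_comp.
by apply: eq_imagel => p _ /=; rewrite addrA.
Qed.

Lemma translate_sym (s t : set V) : translate s t -> translate t s.
Proof.
move=> [v ->]; exists (- v); rewrite image_comp.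
by rewrite -[LHS]image_id; apply: eq_imagel => p _ /=; rewrite addrK.
Qed.

Lemma act_set_comp r s (S : set V) :
  act_set (r, 0) (act_set (s, 0) S) = act_set (r *m s, 0) S.
Proof.
rewrite /act_set image_comp; apply: eq_imagel => p _ /=.
by rewrite /act /= !addr0 mulmxA.
Qed.

Lemma translate_rot r (s t : set V) :
  translate s t -> translate (act_set (r, 0) s) (act_set (r, 0) t).
Proof.
move=> [v ->]; exists (r *m v); rewrite /act_set !image_comp.
by apply: eq_imagel => p _ /=; rewrite /act /= !addr0 mulmxDr.
Qed.

Lemma congruent_rot (j : set V) r s : SO r -> congruent j s ->
  congruent j (act_set (r, 0) s).
Proof.
move=> rSO [g gE ->]; exists (r *m g.1, r *m g.2).
  by have [_ _ + _] := @SO_subgroupT R m; apply.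
rewrite /act_set image_comp; apply: eq_imagel => p _ /=.
by rewrite /act /= addr0 mulmxDr mulmxA.
Qed.

Lemma orient_group_indep j x a b :
  x a -> congruent j a -> x b -> congruent j b ->
  SO_generated (rel_rotations j a x) `<=` SO_generated (rel_rotations j b x).
Proof.
move=> xa ja xb jb.
have [SOsub SO1 SOM SOV] := @SO_subgroupT R m.
have RSO c : rel_rotations j c x `<=` SO by move=> r [].
have Gsub := SO_generated_subgroup (RSO b).
have [_ _ GM GV] := Gsub.
apply: smallest_sub => // r rR; have [rSO [c [xc jc] [_ _ rca]]] := rR.
have [h hE eb] : congruent a b.
  have [g gSO ea] := ja; have [k kSO eb] := jb.
  have [gu gV] := mx_SO_inv gSO.
  exists (k.1 *m invmx g.1, k.2 - k.1 *m invmx g.1 *m g.2).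
    by apply: SOM => //; apply: SOV.
  rewrite eb ea /act_set image_comp; apply: eq_imagel => p _ /=.
  by rewrite /act /= mulmxDr -!mulmxA mulKmx // [k.2 - _]addrC addrA addrK.
have hab : translate (act_set (h.1, 0) a) b.
  exists h.2; rewrite eb /act_set image_comp; apply: eq_imagel => p _ /=.
  by rewrite /act /= addr0.
have h1R : rel_rotations j b x h.1.
  split=> //; exists a => //; split=> //; exact: congruent_rot.
have hrR : rel_rotations j b x (h.1 *m r).
  split; first exact: SOM.
  exists c => //; split=> //; first by apply: congruent_rot => //; exact: SOM.
  by rewrite -act_set_comp; apply: translate_trans hab; exact: translate_rot.
have [hu _] := mx_SO_inv hE.
rewrite -[r](mulKmx hu); apply: GM; last exact: sub_gen_smallest.
by apply: GV; exact: sub_gen_smallest.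
Qed.

Lemma orient_groupE j x a : x a -> congruent j a ->
  orient_group j x = SO_generated (rel_rotations j a x).
Proof.
move=> xa ja; have [xb jb] : [set a | x a /\ congruent j a]
    (xget set0 [set a | x a /\ congruent j a]) by apply: xgetPex; exists a.
by apply/seteqP; split; apply: orient_group_indep.
Qed.

End Tilings.

(* Main.v *)
(* Every supertile phi^n b occurs, up to a rigid motion, in every x in X_phi.
   Indeed the tiles of x through the points of a fine enough finite net of a
   large cube lie in a copy of a supertile phi^(n+1+k) a, and the copy of some
   phi^(n+1) u inside it that reaches the origin stays within the cube. Each
   tile of that copy contains a net point in its interior, so it overlaps, hence
   equals, a tile of x; and phi^(n+1) u contains a copy of phi^n b. Consequently
   every finite patch of y in X_phi occurs in x up to a rigid motion. Applied to
   pairs {b, c} in y this expresses a relative rotation of y, conjugated by a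
   fixed rotation u with u b parallel to a in x, as a product of a relative
   rotation of x and the inverse of another. *)

Require Import Defs.
From mathcomp Require Import all_boot all_order all_algebra.
From mathcomp Require Import all_classical all_reals all_analysis.
From mathcomp Require Import ring lra.
Set Implicit Arguments.
Unset Strict Implicit.
Unset Printing Implicit Defensive.
Import Order.TTheory GRing.Theory Num.Theory.
(* [support] and [patch] would otherwise denote the MathComp notions. *)
Import Defs.
Import numFieldNormedType.Exports.
Local Open Scope classical_set_scope.
Local Open Scope ring_scope.

(** * Coordinatewise geometry: boundedness, interiors, rigid motions, finite nets *)

Section Geometry.
Context {R : realType} {m : nat}.
Local Notation V := 'cV[R]_m.
Implicit Types (p q : V) (S T : set V) (g h : 'M[R]_m * V).

(** The sup-norm ball; sizes are measured in this norm throughout, at the cost of factors of [m]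
    under rotations. *)
Definition coord_near (e : R) p q := forall i, `|p i 0 - q i 0| < e.

Lemma interior_coordP S p :
  S° p <-> exists2 e, 0 < e & coord_near e p `<=` S.
Proof.
split.
- move=> /nbhs_ballP [e /= e0 eS]; exists e => // q pq; apply: eS.
  by split=> // i k; rewrite (ord1 k); exact: pq.
- move=> [e e0 eS]; apply/nbhs_ballP; exists e => //= q [_ pq].
  by apply: eS => i; exact: pq.
Qed.

Lemma interior_coord_near S p :
  S° p -> exists2 e, 0 < e & coord_near e p `<=` S°.
Proof.
move=> Sp; apply/interior_coordP.
by have := open_interior S; rewrite openE; apply.
Qed.

Lemma convex_set_comb S p q (t : R) :
  convex_set (S : set (convex_lmodType V)) -> S p -> S q -> 0 <= t -> t <= 1 ->
  S (t *: p + (1 - t) *: q).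
Proof.
move=> cS /mem_set Sp /mem_set Sq t0 t1.
by have := cS _ _ (Itv01 t0 t1) Sp Sq; rewrite inE.
Qed.

Lemma convex_hull_convex S :
  convex_set (convex_hull S : set (convex_lmodType V)).
Proof.
move=> p q t /set_mem Sp /set_mem Sq; apply/mem_set => C CC.
have [cC _] := CC; apply: set_mem; apply: cC; apply: mem_set.
  exact: Sp.
exact: Sq.
Qed.

Definition coord_bounded S :=
  exists n : nat, forall p, S p -> forall i, `|p i 0| <= n%:R.

Lemma coord_boundedU S T :
  coord_bounded S -> coord_bounded T -> coord_bounded (S `|` T).
Proof.
move=> [k kS] [l lT]; exists (maxn k l) => p [/kS|/lT] + i => /(_ i) pi;
  by apply: le_trans pi _; rewrite ler_nat ?leq_maxl ?leq_maxr.
Qed.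

Lemma coord_bounded1 p : coord_bounded [set p].
Proof.
exists (Num.truncn (\sum_i `|p i 0|)).+1 => _ -> i.
have le_sum : `|p i 0| <= \sum_i `|p i 0|.
  by rewrite (bigD1 i) //= lerDl sumr_ge0.
by apply: le_trans le_sum _; apply/ltW/truncnS_gt.
Qed.

Lemma finite_coord_bounded S : finite_set S -> coord_bounded S.
Proof.
move=> /finite_seqP [s ->]; elim: s => [|p s IHs]; first by exists 0%N.
suff -> : [set` p :: s] = [set p] `|` [set` s].
  by apply: coord_boundedU => //; exact: coord_bounded1.
by apply/seteqP; split=> q /=; rewrite inE => /predU1P.
Qed.

Lemma convex_hull_coord_bounded S :
  coord_bounded S -> coord_bounded (convex_hull S).
Proof.
move=> [n nS]; exists n => p.
suff : convex_hull S `<=` [set p | forall i, `|p i 0| <= n%:R] by apply.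
apply: smallest_sub => // {}p q t; rewrite !inE => pn qn i.
rewrite mxE [X in X + _]mxE [X in _ + X]mxE.
apply: le_trans (ler_normD _ _) _; rewrite !normrM.
have t1 : 0 <= unstable.onem t%:num by rewrite subr_ge0.
rewrite (ger0_norm t1) ger0_norm //.
have -> : n%:R = t%:num * n%:R + (1 - t%:num) * n%:R :> R by ring.
by apply: lerD; apply: ler_wpM2l.
Qed.

Lemma polyhedron_coord_bounded S : polyhedron S -> coord_bounded S.
Proof.
move=> [k [Q [QP ->]]].
have bQ i : coord_bounded (Q i).
  have [_ [F finF ->]] := QP i.
  exact/convex_hull_coord_bounded/finite_coord_bounded.
have [n nQ] := boolp.choice bQ.
exists (\max_i n i) => p [i _ Qp] l; apply: le_trans (nQ i p Qp l) _.
by rewrite ler_nat leq_bigmax.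
Qed.

(** A small step from [p] towards an interior point carries along a shrunken ball that stays in the
    convex set. *)
Lemma convex_interior_closure S p (e : R) :
  convex_set (S : set (convex_lmodType V)) -> S° !=set0 -> S p -> 0 < e ->
  exists2 q, S° q & coord_near e p q.
Proof.
move=> cS [c /interior_coordP [d d0 dS]] Sp e0.
have [n cpn] : coord_bounded [set c - p] by exact: coord_bounded1.
(* The bound 1 keeps the combination convex; the other makes the displacement, at most [t * n],
   smaller than [e]. *)
pose t := Num.min 1 (e / n.+1%:R); exists (t *: c + (1 - t) *: p).
  have t0 : 0 < t by rewrite lt_min ltr01 divr_gt0.
  apply/interior_coordP; exists (t * d); first exact: mulr_gt0.
  move=> q qd.
  (* The ball of radius [t * d] is the image of the ball about [c] under the homothety of centre [p]
     and ratio [t]. *)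
  have -> : q = t *: (t^-1 *: (q - (1 - t) *: p)) + (1 - t) *: p.
    by rewrite scalerA divff ?gt_eqF // scale1r subrK.
  apply: convex_set_comb => //; [apply: dS => i | exact: ltW |].
    rewrite -(ltr_pM2l t0) -{1}(gtr0_norm t0) -normrM !mxE.
    rewrite mulrBr mulrA divff ?gt_eqF // mul1r.
    by have := qd i; rewrite !mxE; rewrite opprB addrA.
  by rewrite /t ge_min lexx.
have t0 : 0 <= t by rewrite le_min ler01 divr_ge0 // ltW.
move=> i; have := cpn _ erefl i; rewrite !mxE => ci.
have -> : p i 0 - (t * c i 0 + (1 - t) * p i 0) = - t * (c i 0 - p i 0) by ring.
rewrite normrM normrN (ger0_norm t0).
apply: (@le_lt_trans _ _ (e / n.+1%:R * n%:R)).
  by apply: ler_pM => //; rewrite /t ge_min lexx orbT.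
by rewrite -mulrA gtr_pMr // mulrC ltr_pdivrMr // mul1r ltr_nat.
Qed.

Lemma polyhedron_interior_closure S p (e : R) :
  polyhedron S -> S p -> 0 < e -> exists2 q, S° q & coord_near e p q.
Proof.
move=> [k [Q [QP ->]]] [i _ Qp] e0.
have [Q0 [F _ QF]] := QP i.
have [q qQ pq] : exists2 q, (Q i)° q & coord_near e p q.
  apply: convex_interior_closure => //; rewrite QF.
  exact: convex_hull_convex.
by exists q => //; move: qQ; apply: interiorS => x Qx; exists i.
Qed.

Lemma polyhedron_interior_nonempty S : polyhedron S -> S° !=set0.
Proof.
move=> [k [Q [QP ->]]]; have [[q qQ] _] := QP ord0.
by exists q; move: qQ; apply: interiorS => x Qx; exists ord0.
Qed.

Definition GE_mul g h : 'M[R]_m * V := (g.1 *m h.1, g.1 *m h.2 + g.2).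

Definition GE_inv g : 'M[R]_m * V := (invmx g.1, - (invmx g.1 *m g.2)).

Lemma GE_mulP g h : GE g -> GE h -> GE (GE_mul g h).
Proof. by have [_ _ + _] := @SO_subgroupT R m; apply. Qed.

Lemma GE_invP g : GE g -> GE (GE_inv g).
Proof. by have [_ _ _] := @SO_subgroupT R m; apply. Qed.

Lemma act_mul g h p : act (GE_mul g h) p = act g (act h p).
Proof. by rewrite /act /= mulmxDr mulmxA addrA. Qed.

Lemma act_invK g : GE g -> cancel (act g) (act (GE_inv g)).
Proof.
by move=> /mx_SO_inv [gu _] p; rewrite /act /= mulmxDr mulKmx // addrK.
Qed.

Lemma act_Kinv g : GE g -> cancel (act (GE_inv g)) (act g).
Proof.
move=> /mx_SO_inv [gu _] p.
by rewrite /act /= mulmxDr mulmxN !mulKVmx // subrK.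
Qed.

Lemma act_set1 S : act_set (1%:M, 0) S = S.
Proof.
rewrite /act_set -[RHS]image_id; apply: eq_imagel => p _.
by rewrite /act /= mul1mx addr0.
Qed.

Lemma act_set_mul g h S : act_set (GE_mul g h) S = act_set g (act_set h S).
Proof.
by rewrite /act_set image_comp; apply: eq_imagel => p _; exact: act_mul.
Qed.

Lemma act_set_invK g : GE g -> cancel (act_set g) (act_set (GE_inv g)).
Proof.
move=> gE S; rewrite /act_set image_comp -[RHS]image_id.
by apply: eq_imagel => p _; exact: act_invK.
Qed.

Lemma SO_entry_le1 (r : 'M[R]_m) i k : SO r -> `|r i k| <= 1.
Proof.
move=> [rr _]; have : (r *m r^T) i i = 1 by rewrite rr mxE eqxx.
rewrite mxE (bigD1 k) //= mxE -expr2 => rE.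
rewrite -(@expr_le1 _ 2) // real_normK ?num_real // -rE lerDl.
by apply: sumr_ge0 => l _; rewrite mxE -expr2 sqr_ge0.
Qed.

Lemma act_coord_le g p q (e : R) : GE g -> (forall i, `|p i 0 - q i 0| <= e) ->
  forall i, `|act g p i 0 - act g q i 0| <= m%:R * e.
Proof.
move=> gE pq i; rewrite !mxE opprD addrACA subrr addr0 -sumrB.
apply: le_trans (ler_norm_sum _ _ _) _.
rewrite mulr_natl -[m in leRHS]card_ord -sumr_const; apply: ler_sum => k _.
rewrite -mulrBr normrM -[leRHS]mul1r.
by apply: ler_pM => //; exact: SO_entry_le1.
Qed.

(** A rotation enlarges coordinate differences at most [m] times; dividing by [m.+1] makes the bound
    strict and covers dimension 0. *)
Lemma act_coord_near g p q (e : R) : GE g -> 0 < e ->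
  coord_near (e / m.+1%:R) p q -> coord_near e (act g p) (act g q).
Proof.
move=> gE e0 pq i.
apply: le_lt_trans (act_coord_le gE (fun i => ltW (pq i)) i) _.
rewrite mulrCA gtr_pMr // ltr_pdivrMr // mul1r ltr_nat //.
Qed.

Lemma coord_near_act_set g S p (e : R) : GE g -> 0 < e ->
  coord_near e p `<=` S -> coord_near (e / m.+1%:R) (act g p) `<=` act_set g S.
Proof.
move=> gE e0 eS q qp; exists (act (GE_inv g) q); last exact: act_Kinv.
apply: eS; rewrite -[p](act_invK gE).
by apply: act_coord_near => //; exact: GE_invP.
Qed.

Lemma act_set_interior g S : GE g -> (act_set g S)° = act_set g S°.
Proof.
have sub h T p : GE h -> T° p -> (act_set h T)° (act h p).
  move=> hE /interior_coordP [e e0 eT].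
  apply/interior_coordP; exists (e / m.+1%:R); first exact: divr_gt0.
  exact: coord_near_act_set.
move=> gE; apply/seteqP; split=> [p Sp | _ [p Sp <-]]; last exact: sub.
exists (act (GE_inv g) p); last exact: act_Kinv.
by rewrite -(act_set_invK gE S); apply: sub => //; exact: GE_invP.
Qed.

Lemma polyhedron_act_set_interior_closure g S p (e : R) :
  polyhedron S -> GE g -> act_set g S p -> 0 < e ->
  exists2 q, (act_set g S)° q & coord_near e p q.
Proof.
move=> PS gE [p' Sp' <-] e0.
have [|q Sq pq] := polyhedron_interior_closure PS Sp' (e := e / m.+1%:R).
  exact: divr_gt0.
exists (act g q); last exact: act_coord_near.
by rewrite act_set_interior //; exists q.
Qed.


Lemma finite_net (e : R) (n : nat) : 0 < e ->
  exists2 F : set V, finite_set F &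
    forall p, (forall i, `|p i 0| <= n%:R) -> exists2 q, F q & coord_near e p q.
Proof.
(* A grid of mesh [e] starting at [- n] needs this many nodes per axis for every coordinate in
   [[-n, n]] to be rounded down to a node. *)
move=> e0; set N := (Num.truncn ((n + n)%:R / e)).+1.
pose pt (k : {ffun 'I_m -> 'I_N}) : V := \col_i ((k i)%:R * e - n%:R).
exists (range pt); first exact/finite_image/finite_finset.
move=> p pn.
have p0 i : 0 <= (p i 0 + n%:R) / e.
  by apply: divr_ge0; [have := pn i; rewrite ler_norml; lra | exact: ltW].
have pN i : (Num.truncn ((p i (0 : 'I_1)%R + n%:R) / e)%R < N)%N.
  rewrite ltnS; apply: le_truncn; rewrite ler_pM2r ?invr_gt0 //.
  by rewrite natrD; have := pn i; rewrite ler_norml; lra.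
exists (pt [ffun i => Ordinal (pN i)]) => // i; rewrite !mxE ffunE /=.
have /andP[] := truncn_itv (p0 i).
rewrite ler_pdivlMr // ltr_pdivrMr // -natr1 [(_ + 1) * e]mulrDl mul1r.
by rewrite ltr_norml; lra.
Qed.

Definition coord_width (n : nat) S :=
  forall p q, S p -> S q -> forall i, `|p i 0 - q i 0| <= n%:R.

Lemma coord_bounded_width S : coord_bounded S -> exists n, coord_width n S.
Proof.
move=> [n nS]; exists (n + n)%N => p q Sp Sq i; rewrite natrD.
by apply: le_trans (ler_normB _ _) _; apply: lerD; exact: nS.
Qed.

Lemma coord_width_act n g S : GE g -> coord_width n S ->
  coord_width (m * n) (act_set g S).
Proof.
move=> gE nS _ _ [p Sp <-] [q Sq <-] i; rewrite natrM.
by apply: act_coord_le => // k; exact: nS.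
Qed.

Lemma coord_width_stretch lam n S : coord_width n S ->
  coord_width ((Num.truncn `|lam|).+1 * n) (stretch lam S).
Proof.
move=> nS _ _ [p Sp <-] [q Sq <-] i; rewrite !mxE -mulrBr normrM natrM.
by apply: ler_pM => //; [exact/ltW/truncnS_gt | exact: nS].
Qed.

End Geometry.

(** By monotonicity the maximum of finitely many witnesses serves for all elements. This makes
    estimates on prototiles uniform. *)
Lemma finite_set_uniform_nat (T : eqType) (A : set T) (Q : T -> nat -> Prop) :
  finite_set A -> (forall b k l, (k <= l)%N -> Q b k -> Q b l) ->
  (forall b, A b -> exists n, Q b n) -> exists n, forall b, A b -> Q b n.
Proof.
move=> /finite_seqP [s ->] Qmono.
elim: s => [|b s IHs] Qex; first by exists 0%N.
have [k Qk] : exists n, Q b n by apply: Qex => /=; rewrite inE eqxx.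
have [c cs|l Ql] := IHs.
  by apply: Qex => /=; rewrite inE; apply/orP; right.
exists (maxn k l) => c /=; rewrite inE => /predU1P [->|cs].
  exact: Qmono (leq_maxl _ _) Qk.
exact: Qmono (leq_maxr _ _) (Ql c cs).
Qed.

(** * Rigid motions acting on patches; overlap and inradius of tiles *)

Section Patches.
Context {R : realType} {m : nat}.
Local Notation V := 'cV[R]_m.
Implicit Types (A P Q : set (set V)) (g h : 'M[R]_m * V) (s t : set V).

Lemma act_patch_mul g h P :
  act_patch (GE_mul g h) P = act_patch g (act_patch h P).
Proof.
by rewrite /act_patch image_comp; apply: eq_imagel => t _; exact: act_set_mul.
Qed.

Lemma act_patch_invK g : GE g -> cancel (act_patch g) (act_patch (GE_inv g)).
Proof.
move=> gE P; rewrite /act_patch image_comp -[RHS]image_id.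
by apply: eq_imagel => t _; exact: act_set_invK.
Qed.

Lemma act_patch1 g t : act_patch g [set t] = [set act_set g t].
Proof. exact: image_set1. Qed.

Lemma support_act_patch g P : support (act_patch g P) = act_set g (support P).
Proof.
apply/seteqP; split.
  by move=> _ [_ [t Pt <-] [p tp <-]]; exists p => //; exists t.
move=> _ [p [t Pt tp] <-]; exists (act_set g t); first by exists t.
by exists p.
Qed.

Lemma tile_alphabet A b : A b -> tile A b.
Proof.
move=> Ab; exists b => //; exists (1%:M, 0); last by rewrite act_set1.
by split; rewrite /= ?trmx1 ?mulmx1 ?det1.
Qed.

Lemma tile_act A g t : GE g -> tile A t -> tile A (act_set g t).
Proof.
move=> gE [b Ab [h hE ->]]; exists b => //; exists (GE_mul g h).
  exact: GE_mulP.
by rewrite act_set_mul.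
Qed.

Lemma tiling_act A g x : GE g -> tiling A x -> tiling A (act_patch g x).
Proof.
move=> gE [xA xT xD]; split.
- by move=> _ [t xt <-]; apply: tile_act => //; exact: xA.
- rewrite support_act_patch xT; apply/seteqP; split=> // p _.
  by exists (act (GE_inv g) p) => //; exact: act_Kinv.
- move=> _ _ [s xs <-] [t xt <-] st; rewrite !act_set_interior //.
  have /(xD s t xs xt) st0 : s <> t by move=> eq_st; apply: st; rewrite eq_st.
  apply/seteqP; split=> // _ [[p sp <-] [q tq /(can_inj (act_invK gE)) qp]].
  have : (s° `&` t°) p by split=> //; rewrite -qp.
  by rewrite st0.
Qed.

Lemma patch_act A g P : GE g -> patch A P -> patch A (act_patch g P).
Proof.
move=> gE [x xT Px]; exists (act_patch g x); first exact: tiling_act.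
exact: image_subset.
Qed.

Lemma sub_patch A P Q : P `<=` Q -> patch A Q -> patch A P.
Proof. by move=> PQ [x xT Qx]; exists x => // t /PQ /Qx. Qed.

Lemma patch_tile A P t : patch A P -> P t -> tile A t.
Proof. by move=> [x [xA _ _] Px] /Px /xA. Qed.

Lemma patch_congruent_act g P Q :
  GE g -> patch_congruent Q P -> patch_congruent (act_patch g Q) P.
Proof.
move=> gE [h hE ->]; exists (GE_mul h (GE_inv g)).
  by apply: GE_mulP => //; exact: GE_invP.
by rewrite act_patch_mul act_patch_invK.
Qed.

(** The point [p] may lie on the boundary of [t]; points of [t°] close enough to it still lie in
    [s°], against disjointness of interiors. *)
Lemma patch_overlap A P s t p : alphabet A -> patch A P -> P s -> P t ->
  s° p -> t p -> s = t.
Proof.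
move=> [_ _ Apoly _] [x [xA _ xD] Px] /Px xs /Px xt sp tp.
apply: contrapT => /(xD _ _ xs xt) st0.
have [b Ab [g gE eq_t]] := xA _ xt.
have [e e0 es] := interior_coord_near sp.
have btp : act_set g b p by rewrite -eq_t.
have [q tq pq] :=
  polyhedron_act_set_interior_closure (Apoly _ Ab) gE btp e0.
have : (s° `&` t°) q by split; [exact: es | rewrite eq_t].
by rewrite st0.
Qed.

(** Finitely many prototiles share a radius, which later serves as the mesh of a net hitting tile
    interiors. *)
Lemma uniform_inradius A : alphabet A -> exists2 e : R, 0 < e &
  forall t, tile A t -> exists c, coord_near e c `<=` t°.
Proof.
move=> [_ finA Apoly _].
have [|b Ab|k Ak] := @finite_set_uniform_nat _ A
    (fun b k => exists c, coord_near (k.+1%:R^-1 : R) c `<=` b°) finA.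
- move=> b k l kl [c cb]; exists c => q cq; apply: cb => i.
  by apply: lt_le_trans (cq i) _; rewrite lef_pV2 ?posrE // ler_nat.
- have [c cb] := polyhedron_interior_nonempty (Apoly b Ab).
  have [e e0 eb] := interior_coord_near cb.
  exists (Num.truncn e^-1); exists c => q cq; apply: eb => i.
  apply: lt_le_trans (cq i) _.
  by rewrite invf_ple ?posrE //; exact/ltW/truncnS_gt.
exists (k.+1%:R^-1 / m.+1%:R); first by rewrite divr_gt0.
move=> _ [b Ab [g gE ->]]; have [c cb] := Ak b Ab.
exists (act g c); rewrite act_set_interior //.
by apply: coord_near_act_set.
Qed.

End Patches.

(** * Iterates of a substitution and the size of supertiles *)

Section Substitution.
Context {R : realType} {m : nat}.
Local Notation V := 'cV[R]_m.
Context {A : set (set V)} {phi : set (set V) -> set (set V)} {lam : R}.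
Hypotheses (HA : alphabet A) (Hphi : substitution A phi lam).
Context {x0 : set (set V)} (tx0 : tiling A x0).
Implicit Types (P Q : set (set V)) (g h : 'M[R]_m * V) (s t : set V).

(** Some type occurs in [x0], and by primitivity one substitution of that tile produces every
    type. *)
Lemma tile_patch t : tile A t -> patch A [set t].
Proof.
move=> [b Ab [g gE ->]].
have [x0A x0T _] := tx0.
have [t0 x0t0 _] : support x0 0 by rewrite x0T.
have [b0 Ab0 [h hE eq_t0]] := x0A t0 x0t0.
have pb0 : patch A [set b0].
  rewrite -[b0](act_set_invK hE) -eq_t0 -act_patch1.
  apply: patch_act; first exact: GE_invP.
  by exists x0 => // _ ->.
have [u b0u [k kE eq_u]] := subst_primitive Hphi Ab0 Ab.
have -> : [set act_set g b] = act_patch (GE_mul g (GE_inv k)) [set u].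
  by rewrite act_patch1 act_set_mul eq_u act_set_invK.
apply: patch_act; first by apply: GE_mulP => //; exact: GE_invP.
by apply: sub_patch (subst_patch Hphi pb0) => _ ->.
Qed.

Lemma iter_patch n P : patch A P -> patch A (iter n phi P).
Proof.
by move=> pP; elim: n => //= n; exact: subst_patch Hphi _.
Qed.

Lemma iter_bigcup n P : patch A P ->
  iter n phi P = \bigcup_(t in P) iter n phi [set t].
Proof.
move=> pP; elim: n => [|n IHn] /=; first by rewrite bigcup_imset1 image_id.
have iterE t : P t ->
    phi (iter n phi [set t]) = \bigcup_(a in iter n phi [set t]) phi [set a].
  move=> Pt; apply: (subst_tilewise Hphi); apply: iter_patch.
  by apply: sub_patch pP => _ ->.
rewrite (subst_tilewise Hphi (iter_patch n pP)) IHn; apply/seteqP; split=> s.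
  by move=> [a [t Pt ta] as_]; exists t => //; rewrite iterE //; exists a.
by move=> [t Pt]; rewrite iterE // => -[a ta as_]; exists a => //; exists t.
Qed.

Lemma iter_stretch_GE n g : GE g -> GE (iter n (stretch_conj lam) g).
Proof. by move=> gE; elim: n. Qed.

Lemma iter_act n g P : GE g -> patch A P ->
  iter n phi (act_patch g P) =
  act_patch (iter n (stretch_conj lam) g) (iter n phi P).
Proof.
move=> gE pP; elim: n => //= n ->.
rewrite (subst_equivariant Hphi) //; first exact: iter_stretch_GE.
exact: iter_patch.
Qed.

Lemma iter_tile n P t : patch A P -> P t ->
  iter n phi [set t] `<=` iter n phi P.
Proof.
by move=> pP Pt s ts; rewrite iter_bigcup //; exists t.
Qed.

(** The level is [n.+1] because [subst_support] applies from level 1 on; the bound for prototiles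
    passes to all tiles by equivariance. *)
Lemma uniform_width n : exists k, forall t, tile A t ->
  coord_width k (support (iter n.+1 phi [set t])).
Proof.
have [_ finA Apoly _] := HA.
have [|b Ab|k Ak] := @finite_set_uniform_nat _ A
    (fun b k => coord_width k (support (iter n.+1 phi [set b]))) finA.
- move=> b k l kl bk p q bp bq i; apply: le_trans (bk p q bp bq i) _.
  by rewrite ler_nat.
- have [g gE ->] := subst_support Hphi Ab (ltn0Sn n).
  have [k bk] := coord_bounded_width (polyhedron_coord_bounded (Apoly b Ab)).
  by eexists; apply: coord_width_act => //; exact: coord_width_stretch bk.
exists (m * k)%N => _ [b Ab [g gE ->]].
rewrite -act_patch1 iter_act //.
  rewrite support_act_patch; apply: coord_width_act; last exact: Ak.
  exact: iter_stretch_GE.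
exact/tile_patch/tile_alphabet.
Qed.

End Substitution.

(** * Occurrence of every supertile in every tiling of the system *)

Section Recurrence.
Context {R : realType} {m : nat}.
Local Notation V := 'cV[R]_m.
Context {A : set (set V)} {phi : set (set V) -> set (set V)} {lam : R}.
Hypotheses (HA : alphabet A) (Hphi : substitution A phi lam).
Context {x : set (set V)} (Hx : substitution_tiling A phi x).
Implicit Types (P Q : set (set V)) (g h : 'M[R]_m * V) (s t : set V).

Let tx : tiling A x := Hx.1.

(** The definition of [substitution_tiling] does not control the level. It can be raised by one
    since [phi [set a]] contains a copy of [a], whose supertile contains a moved copy of [Q]. *)
Lemma finite_sub_supertile n P : finite_set P -> P `<=` x ->
  exists k a Q, [/\ A a, Q `<=` iter (n + k) phi [set a] & patch_congruent Q P].
Proof.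
move=> finP Px; elim: n => [|n [k [a [Q [Aa Qa QP]]]]].
  by have [k [a [Q [_ Aa Qa QP]]]] := Hx.2 P finP Px; exists k, a, Q.
have pa : patch A [set a] := tile_patch Hphi tx (tile_alphabet Aa).
have [t at_ [g gE eq_t]] := subst_primitive Hphi Aa Aa.
exists k, a, (act_patch (iter (n + k) (stretch_conj lam) g) Q); split=> //.
  rewrite addSn iterSr; apply: (@subset_trans _ (iter (n + k) phi [set t])).
    by rewrite eq_t -act_patch1 (iter_act Hphi) //; exact: image_subset.
  by apply: (iter_tile Hphi) => //; exact: subst_patch Hphi _ pa.
by apply: patch_congruent_act => //; exact: iter_stretch_GE.
Qed.

Lemma supertile_in_tiling n b : A b ->
  exists2 g, GE g & act_patch g (iter n phi [set b]) `<=` x.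
Proof.
move=> Ab; have [xA xT xD] := tx.
have [e e0 inrad] := uniform_inradius HA.
have [D width] := uniform_width HA Hphi tx n.
(* The factor [m] allows for the motion [g] that puts the supertile in place. *)
have [F finF net] := @finite_net R m e (m * D) e0.
(* Tiles through a finite net replace all tiles meeting a ball, whose finiteness
   would need local finiteness of tilings. *)
have tile_at p : exists t, x t /\ t p.
  have [t xt tp] : support x p by rewrite xT.
  by exists t.
have [f fP] := boolp.choice tile_at.
(* Adding the origin to the net ensures that one selected tile contains it, which singles out [u]
   below. *)
have [||k [a [Q [Aa Qa [g gE eq_P]]]]] :=
    @finite_sub_supertile n.+1 (f @` (0 |` F)).
- by apply: finite_image; rewrite finite_setU; split.
- by move=> _ [p _ <-]; have [] := fP p.
have pa : patch A [set a] := tile_patch Hphi tx (tile_alphabet Aa).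
have pka : patch A (iter k phi [set a]) := iter_patch Hphi k pa.
set U := act_patch g (iter (n.+1 + k) phi [set a]).
have pU : patch A U by apply: patch_act => //; exact: (iter_patch Hphi).
have PU p : (0 |` F) p -> U (f p).
  move=> Fp; have : (f @` (0 |` F)) (f p) by exists p.
  by rewrite eq_P => -[t Qt <-]; exists t => //; exact: Qa.
have [t] := PU 0 (or_introl erefl).
rewrite iterD (iter_bigcup Hphi) // => -[u au ut] eq_f0.
have tu : tile A u := patch_tile pka au.
have iter_u_x : act_patch g (iter n.+1 phi [set u]) `<=` x.
  move=> _ [s us <-].
  have Us : U (act_set g s).
    exists s => //; rewrite iterD.
    exact: (iter_tile Hphi) us.
  have [c cs] := inrad _ (patch_tile pU Us).
  have [i|p Fp cp] := net c.
    (* The moved supertile of [u] contains both the origin and [c], so its width bounds the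
       coordinates of [c]. *)
    have -> : c i 0 = c i 0 - (0 : V) i 0 by rewrite mxE subr0.
    apply: (coord_width_act gE (width u tu)).
      rewrite -support_act_patch; exists (act_set g s); first by exists s.
      by apply: interior_subset; apply: cs => l; rewrite subrr normr0.
    rewrite -support_act_patch; exists (act_set g t); first by exists t.
    by rewrite eq_f0; case: (fP 0).
  (* The net point [p] is interior to the moved tile and belongs to [f p]. Both tiles lie in the
     patch [U], so they coincide. *)
  rewrite (patch_overlap HA pU Us (PU p (or_intror Fp)) (cs _ cp)).
    by case: (fP p).
  by case: (fP p).
have [d Ad [h hE eq_u]] := tu.
(* One level is spent here: [phi [set d]] contains a copy of [b], so [iter n.+1 phi [set d]]
   contains a copy of [iter n phi [set b]]. *)
have [v dv [l lE eq_v]] := subst_primitive Hphi Ad Ab.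
have pd : patch A [set d] := tile_patch Hphi tx (tile_alphabet Ad).
have pb : patch A [set b] := tile_patch Hphi tx (tile_alphabet Ab).
have hE' : GE (iter n.+1 (stretch_conj lam) h) by exact: iter_stretch_GE.
have lE' : GE (iter n (stretch_conj lam) l) by exact: iter_stretch_GE.
exists (GE_mul g (GE_mul (iter n.+1 (stretch_conj lam) h)
                         (iter n (stretch_conj lam) l))).
  by do 2!apply: GE_mulP => //.
apply: subset_trans iter_u_x; rewrite !act_patch_mul; apply: image_subset.
rewrite eq_u -act_patch1 (iter_act Hphi) //; apply: image_subset.
rewrite -(iter_act Hphi) // act_patch1 -eq_v iterSr.
by apply: (iter_tile Hphi) => //; exact: subst_patch Hphi _ pd.
Qed.

End Recurrence.

Lemma invmx_mulmx (F : comUnitRingType) n (B C : 'M[F]_n) :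
  B \in unitmx -> C \in unitmx -> invmx (B *m C) = invmx C *m invmx B.
Proof.
move=> Bu Cu; have BCu : B *m C \in unitmx by rewrite unitmx_mul Bu.
by apply: (can_inj (mulmxK BCu)); rewrite mulVmx // mulmxA mulmxKV // mulVmx.
Qed.

(** * Transfer of relative rotations between tilings and conjugacy of the groups *)

Section OrientationGroups.
Context {R : realType} {m : nat}.
Local Notation V := 'cV[R]_m.
Context {A : set (set V)} {phi : set (set V) -> set (set V)} {lam : R}.
Hypotheses (HA : alphabet A) (Hphi : substitution A phi lam).
Implicit Types (P Q x y : set (set V)) (g h : 'M[R]_m * V) (s t : set V).

Lemma finite_subpatch_recurs x y P :
  substitution_tiling A phi x -> substitution_tiling A phi y ->
  finite_set P -> P `<=` y -> exists2 g, GE g & act_patch g P `<=` x.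
Proof.
move=> Hx Hy finP Py.
have [k [b [Q [_ Ab Qb [g gE ->]]]]] := Hy.2 P finP Py.
have [h hE bx] := supertile_in_tiling HA Hphi Hx k Ab.
exists (GE_mul h (GE_inv g)); first by apply: GE_mulP => //; exact: GE_invP.
rewrite act_patch_mul act_patch_invK //.
by apply: subset_trans bx; exact: image_subset.
Qed.

Lemma tile_type_occurs x b : substitution_tiling A phi x -> A b ->
  exists2 t, x t & congruent b t.
Proof.
move=> Hx Ab; have [g gE bx] := supertile_in_tiling HA Hphi Hx 0 Ab.
exists (act_set g b); last by exists g.
by apply: bx; exists b.
Qed.

Lemma translate_act g s : translate (act_set (g.1, 0) s) (act_set g s).
Proof.
exists g.2; rewrite /act_set image_comp; apply: eq_imagel => p _ /=.
by rewrite /act /= addr0.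
Qed.

(* Applying a rigid motion [h] to a tile [c] multiplies the rotation bringing
   it parallel to [a] by [h.1^-1] on the right; this factor cancels in the
   product of one relative rotation with the inverse of another. *)
Lemma rel_rotations_conj x y a b j u : substitution_tiling A phi x ->
  substitution_tiling A phi y -> x a -> congruent j a -> y b ->
  congruent j b -> SO u -> translate (act_set (u, 0) b) a ->
  forall r, rel_rotations j b y r ->
  SO_generated (rel_rotations j a x) (u *m r *m invmx u).
Proof.
move=> Hx Hy xa ja yb jb uSO uba r [rSO [c [yc jc] [_ _ rcb]]].
have [_ SO1 SOM SOV] := @SO_subgroupT R m.
have Rsub : rel_rotations j a x `<=` SO by move=> ? [].
have [_ _ GM GV] := SO_generated_subgroup Rsub.
(* A single motion [h] carries both tiles into [x], so [Rb] and [Rc] share the factor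
   [invmx h.1]. *)
have [||h hE bcx] := @finite_subpatch_recurs x y [set b; c] Hx Hy.
- by rewrite finite_setU; split; exact: finite_set1.
- by move=> _ [] ->.
have jh t : congruent j t -> congruent j (act_set h t).
  by move=> [g gE ->]; exists (GE_mul h g);
    [exact: GE_mulP | rewrite act_set_mul].
have rel v t : SO v -> [set b; c] t -> congruent j t ->
    translate (act_set (v, 0) t) a ->
    rel_rotations j a x (v *m invmx h.1).
  move=> vSO bct jt vta.
  have vhSO : SO (v *m invmx h.1) by apply: SOM => //; exact: SOV.
  split=> //; exists (act_set h t).
    by split; [apply: bcx; exists t | exact: jh].
  split=> //; first by apply: congruent_rot => //; exact: jh.
  apply: translate_trans vta.
  have [hu _] := mx_SO_inv hE.
  have := translate_rot (v *m invmx h.1) (translate_sym (translate_act h t)).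
  by rewrite act_set_comp mulmxKV.
have Rb : rel_rotations j a x (u *m invmx h.1) by apply: (rel u b) => //; left.
have Rc : rel_rotations j a x (u *m r *m invmx h.1).
  apply: (rel _ c) => //; [exact: SOM | by right |].
  by apply: translate_trans uba; rewrite -act_set_comp; exact: translate_rot.
have [uu _] := mx_SO_inv uSO; have [hu _] := mx_SO_inv hE.
have -> : u *m r *m invmx u =
    (u *m r *m invmx h.1) *m invmx (u *m invmx h.1).
  by rewrite invmx_mulmx ?unitmx_inv // invmxK mulmxA mulmxKV.
apply: GM; first exact: sub_gen_smallest.
by apply: GV; exact: sub_gen_smallest.
Qed.

(** The rotations whose conjugate by [u] lies in the group generated by [T] form a subgroup
    containing [S], hence the group it generates. *)
Lemma SO_generated_conj (S T : set 'M[R]_m) u :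
  SO u -> S `<=` SO -> T `<=` SO ->
  (forall r, S r -> SO_generated T (u *m r *m invmx u)) ->
  forall r, SO_generated S r -> SO_generated T (u *m r *m invmx u).
Proof.
move=> uSO SSO TSO ST; have [uu _] := mx_SO_inv uSO.
have [_ SO1 SOM SOV] := @SO_subgroupT R m.
have [Tsub T1 TM TV] := SO_generated_subgroup TSO.
suff : SO_generated S `<=` [set r | SO r /\ SO_generated T (u *m r *m invmx u)].
  by move=> sub r /sub [].
apply: smallest_sub => [|r Sr]; last by split; [exact: SSO | exact: ST].
split.
- by move=> r [].
- by split=> //; rewrite mulmx1 mulmxV.
- move=> r s [rSO Tr] [sSO Ts]; split; first exact: SOM.
  by have := TM _ _ Tr Ts; rewrite !mulmxA mulmxKV.
- move=> r [rSO Tr]; split; first exact: SOV.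
  have [ru _] := mx_SO_inv rSO; have := TV _ Tr.
  by rewrite !invmx_mulmx ?unitmx_mul ?unitmx_inv ?uu // invmxK mulmxA.
Qed.

(** One inclusion of the conjugacy; the other comes from exchanging the tilings and replacing [u] by
    its inverse. *)
Lemma orient_group_conj x y a b j u : substitution_tiling A phi x ->
  substitution_tiling A phi y -> x a -> congruent j a -> y b ->
  congruent j b -> SO u -> translate (act_set (u, 0) b) a ->
  forall r, orient_group j y r -> orient_group j x (u *m r *m invmx u).
Proof.
move=> Hx Hy xa ja yb jb uSO uba.
rewrite (orient_groupE xa ja) (orient_groupE yb jb).
apply: SO_generated_conj => //; [by move=> ? [] | by move=> ? [] |].
exact: rel_rotations_conj.
Qed.

End OrientationGroups.

Theorem lemma1 (R : realType) (m : nat) (A : set (set 'cV[R]_m))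
    (phi : set (set 'cV[R]_m) -> set (set 'cV[R]_m)) (lam : R)
    (HA : alphabet A) (Hphi : substitution A phi lam)
    (j : set 'cV[R]_m) (Hj : A j)
    (x x' : set (set 'cV[R]_m))
    (Hx : substitution_tiling A phi x) (Hx' : substitution_tiling A phi x') :
  (forall a a' : set 'cV[R]_m, x a -> x' a' -> parallel j a' a ->
     orient_group j x = orient_group j x') /\
  (forall y : set (set 'cV[R]_m), substitution_tiling A phi y ->
     SO_conjugate (orient_group j y) (orient_group j x)).
Proof.
have [_ SO1 SOM SOV] := @SO_subgroupT R m.
split.
  move=> a a' xa x'a' [ja' ja aa'].
  (* For parallel tiles the conjugating rotation is the identity. *)
  have inv1 : invmx 1%:M = 1%:M :> 'M[R]_m by exact: invmx1.
  apply/seteqP; split=> r Or.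
    rewrite -[r]mul1mx -[_ *m r]mulmx1 -[X in _ *m X]inv1.
    apply: (orient_group_conj HA Hphi Hx' Hx x'a' ja' xa ja SO1) => //.
    by rewrite act_set1; exact: translate_sym.
  rewrite -[r]mul1mx -[_ *m r]mulmx1 -[X in _ *m X]inv1.
  apply: (orient_group_conj HA Hphi Hx Hx' xa ja x'a' ja' SO1) => //.
  by rewrite act_set1.
move=> y Hy.
have [a xa ja] := tile_type_occurs HA Hphi Hx Hj.
have [b yb jb] := tile_type_occurs HA Hphi Hy Hj.
have [g gE eq_a] := ja; have [h hE eq_b] := jb.
have [hu _] := mx_SO_inv hE.
(* This undoes the rotation that placed [j] at [b] and applies the one that placed it at [a]. *)
set u := g.1 *m invmx h.1.
have uSO : SO u by apply: SOM => //; exact: SOV.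
have [uu _] := mx_SO_inv uSO.
have uba : translate (act_set (u, 0) b) a.
  rewrite eq_a eq_b; apply: translate_trans (translate_act g j).
  have := translate_rot u (translate_sym (translate_act h j)).
  by rewrite act_set_comp mulmxKV.
have uab : translate (act_set (invmx u, 0) a) b.
  have := translate_rot (invmx u) (translate_sym uba).
  by rewrite act_set_comp mulVmx // act_set1.
clearbody u; exists u => //; apply/seteqP; split=> r; last first.
  move=> [s Os <-].
  exact: (orient_group_conj HA Hphi Hx Hy xa ja yb jb uSO uba).
move=> Or; exists (invmx u *m r *m u).
  rewrite -[X in _ *m X]invmxK.
  exact: (orient_group_conj HA Hphi Hy Hx yb jb xa ja (SOV _ uSO) uab).
by rewrite !mulmxA mulmxV // mul1mx mulmxK.
Qed.
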